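(* Let $n$ be a positive integer that is not of the form $p^m$ with $p$ a prime and $m$ a non-negative integer. Let $C_n$ be the cyclic group of order $n$ and let $\lambda_2(\mathcal{P}(C_n))$ be the second largest eigenvalue of its power graph $\mathcal{P}(C_n)$. Then $\lambda_2(\mathcal{P}(C_n))\ge \mu_2$, where $\mu_2$ is the second largest root of the equation $\mu^{3}-\mu^{2}-3\mu+1=0$; moreover $\mu_2>0.31$.
   Context: The power graph $\mathcal{P}(\mathbb{G})$ of a finite group $\mathbb{G}$ is the simple undirected graph with vertex set $\mathbb{G}$ in which two distinct elements $x,y$ are adjacent if and only if one of them is an integral power of the other. The eigenvalues of a graph $G$ on $N$ vertices are those of its adjacency matrix, listed with multiplicity as $\lambda_1(G)\ge\lambda_2(G)\ge\cdots\ge\lambda_N(G)$; $\lambda_2(G)$ is the second largest eigenvalue. *)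

(* Defs.v *)
From mathcomp Require Import all_boot all_order all_fingroup all_algebra all_solvable.
From mathcomp Require Import polyrcf.

Set Implicit Arguments.
Unset Strict Implicit.
Unset Printing Implicit Defensive.

Import Order.TTheory GRing.Theory Num.Theory.

Local Open Scope ring_scope.

Definition power_adj (gT : finGroupType) : rel gT :=
  fun x y => (x != y) && ((x \in <[y]>%g) || (y \in <[x]>%g)).

(* Negative exponents add nothing in a finite group. *)
Lemma power_adjP (gT : finGroupType) (x y : gT) :
  reflect (x <> y /\ ((exists k : nat, x = (y ^+ k)%g) \/
                      (exists k : nat, y = (x ^+ k)%g)))
          (power_adj x y).
Proof.
apply: (iffP andP) => [[/eqP xy /orP xyP]|[/eqP xy xyP]].
  by split=> //; case: xyP => /cycleP; [left|right].
by split=> //; apply/orP; case: xyP => /cycleP; [left|right].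
Qed.

Definition adjmx (R : nzRingType) (T : finType) (V : {set T}) (e : rel T) :
  'M[R]_#|V| := \matrix_(i, j) (e (enum_val i) (enum_val j))%:R.

(* [rootsR p] is the increasing list of the distinct roots of p in R, and
   [mup x p] is the multiplicity of x as a root of p. *)
Definition dec_roots (R : rcfType) (p : {poly R}) : seq R :=
  flatten [seq nseq (mup x p) x | x <- rev (rootsR p)].

Definition eigenvalues (R : rcfType) (n : nat) (A : 'M[R]_n) : seq R :=
  dec_roots (char_poly A).

(* Lists are indexed from 0, so the second largest entry has index 1. *)
Definition second_largest_root (R : rcfType) (p : {poly R}) : R :=
  (dec_roots p)`_1.

Definition lambda2 (R : rcfType) (T : finType) (V : {set T}) (e : rel T) : R :=
  (eigenvalues (adjmx R V e))`_1.

Lemma dec_roots_prod (R : rcfType) (s : seq R) :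
  sorted >=%R s -> dec_roots (\prod_(x <- s) ('X - x%:P)) = s.
Proof.
move=> s_dec; set p := \prod_(x <- s) _.
have p0 : p != 0 by rewrite monic_neq0 // monic_prod_XsubC.
have r_uniq : uniq (rev (rootsR p)) by rewrite rev_uniq uniq_roots.
have r_dec : sorted >%R (rev (rootsR p)).
  by rewrite rev_sorted; exact: sorted_roots.
have memr x : (x \in rev (rootsR p)) = (x \in s).
  by rewrite mem_rev -roots_on_rootsR // inE /= root_prod_XsubC.
have cnt t x : uniq t ->
    count_mem x (flatten [seq nseq (mup y p) y | y <- t])
    = if x \in t then mup x p else 0%N.
  elim: t => //= y t IH /andP[yt /IH]; rewrite count_cat => ->.
  rewrite count_nseq /= inE eq_sym; case: eqVneq => [->|_] /=.
    by rewrite mul1n (negbTE yt) addn0.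
  by rewrite mul0n.
apply: (@sorted_eq _ >=%R) => //.
- by move=> y x z /= xy /le_trans; apply; exact: xy.
- by move=> x y /= /andP[? ?]; apply/eqP; rewrite eq_le; apply/andP.
- rewrite /dec_roots; elim: (rev _) r_dec {r_uniq memr} => //= y t IH yt.
  have {IH} := IH (path_sorted yt).
  set u := flatten _ => u_dec.
  have yu : all (fun z => z <= y) u.
    apply/allP => z /flattenP[w /mapP[v vt ->]] /nseqP[-> _] /=.
    have gt_tr : transitive (>%R : rel R) by move=> a b c /= ba /lt_trans; apply; exact: ba.
    by have /allP/(_ _ vt) /ltW := order_path_min gt_tr yt.
  elim: (mup y p) => //= m IHm; rewrite path_sortedE; last first.
    by move=> a b c /= ba /le_trans; apply; exact: ba.
  rewrite IHm andbT all_cat yu andbT; apply/allP => z /nseqP[-> _] /=.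
  exact: lexx.
apply/allP => x _ /=; apply/eqP.
rewrite cnt // memr mu_prod_XsubC; case: ifP => // /negbT xs.
by apply/esym/count_memPn.
Qed.

(* Main.v *)
Require Import Defs.
From mathcomp Require Import all_boot all_order all_fingroup all_algebra all_solvable.
From mathcomp Require Import polyrcf.
From mathcomp Require Import complex spectral sesquilinear ring lra.

(** A number that is not a prime power has two prime divisors q < p, and then p
    is odd.  By Cauchy, a group of order n contains x of order q and y of
    order p; since p > 2, the elements 1, y, y^-1, x are distinct.  In the
    power graph they induce the paw: 1 is adjacent to everything, y and y^-1
    generate the same subgroup, and x, whose order is a different prime, is
    adjacent to neither of them.

    The characteristic polynomial of the paw is (X + 1) times the cubic
    X^3 - X^2 - 3 X + 1, whose sign changes on ]-2, -1[, ]0.31, 1[ and ]2, 3[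
    locate its three real roots and show that the second one exceeds 0.31
    ([paw_cubic_roots]).  So the paw has two independent eigenvectors with
    eigenvalues at least mu_2 and, by Cauchy interlacing, the second largest
    eigenvalue of any graph with an induced paw is at least mu_2
    ([second_eigenvalue_of_induced_paw]).

    Interlacing is derived from the easy half of the Courant-Fischer theorem
    ([courant_fischer_ge]): if the quadratic form of a real symmetric matrix is
    at least mu times the squared norm on a space of dimension m, then at least
    m eigenvalues are at least mu, because otherwise some nonzero vector of the
    space would be orthogonal to all the corresponding eigenvectors.  The
    eigenvectors come from the unitary diagonalization of Hermitian matrices
    over R[i], so that the hypothesis on real vectors is first transferred to
    complex ones ([real_quadratic_form_ge0]). *)

Set Implicit Arguments.
Unset Strict Implicit.

Import Order.TTheory GRing.Theory Num.Theory.

Local Open Scope ring_scope.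

Local Notation "x %:C" := (real_complex _ x).
Local Open Scope sesquilinear_scope.
Local Notation toC := (map_mx (real_complex _)).

(** * Spectrum of a real symmetric matrix *)

Lemma char_poly_conj (F : fieldType) (N : nat) (P D : 'M[F]_N) :
  P \in unitmx -> char_poly (invmx P *m D *m P) = char_poly D.
Proof.
move=> P_unit; rewrite /char_poly.
have -> : char_poly_mx (invmx P *m D *m P) =
    map_mx polyC (invmx P) *m char_poly_mx D *m map_mx polyC P.
  rewrite /char_poly_mx mulmxBr mulmxBl scalar_mxC -(mulmxA ('X%:M)) -!map_mxM /=.
  by rewrite mulVmx // map_mx1 mulmx1.
rewrite !det_mulmx mulrAC -det_mulmx -map_mxM mulVmx //.
by rewrite map_mx1 det1 mul1r.
Qed.

Lemma eigenvalues_char_poly_split (R : rcfType) (N : nat) (A : 'M[R]_N)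
    (d : 'rV[R]_N) :
  char_poly A = \prod_(i < N) ('X - (d 0 i)%:P) ->
  eigenvalues A = sort >=%R [seq d 0 i | i <- enum 'I_N].
Proof.
move=> dE; rewrite /eigenvalues dE.
rewrite -[RHS]dec_roots_prod; last first.
  by apply: sort_sorted => x y /=; rewrite orbC le_total.
congr dec_roots; rewrite (perm_big _ (permEl (perm_sort _ _))) /=.
by rewrite big_map big_enum.
Qed.

Lemma nth_decreasing_ge (R : rcfType) (s : seq R) (mu : R) (k : nat) :
  sorted >=%R s -> (k < count (>= mu) s)%N -> mu <= s`_k.
Proof.
elim: s k => //= x s IH k; rewrite path_sortedE; last first.
  by move=> a b c /= ba /le_trans; apply.
case/andP=> /allP x_max s_dec k_lt.
case: k k_lt => [|k] k_lt /=.
  have : has (>= mu) (x :: s) by rewrite has_count.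
  by case/orP=> // /hasP[y /x_max /= yx /= muy]; apply: le_trans yx.
by apply: IH => //; move: k_lt; case: (mu <= x) => //= /ltnW.
Qed.

(** The diagonalizing matrix is only obtained over R[i], but its diagonal is
    real because A is Hermitian there; the factorization of the characteristic
    polynomial then descends to R, as polynomials over R embed in those over
    R[i]. *)
Lemma symmetric_spectral (R : rcfType) (N : nat) (A : 'M[R]_N) : A^T = A ->
  exists (d : 'rV[R]_N) (P : 'M[R[i]]_N),
    [/\ P \is unitarymx, toC A = P^t* *m diag_mx (toC d) *m P
      & char_poly A = \prod_(i < N) ('X - (d 0 i)%:P)].
Proof.
move=> A_sym.
have A_herm : toC A \is hermsymmx.
  apply: realsym_hermsym.
    by apply/is_hermitianmxP; rewrite expr0 scale1r map_mx_id // map_trmx A_sym.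
  by apply/mxOverP => i j; rewrite mxE; apply/complex_realP; eexists.
pose P := spectralmx (toC A); have P_unitary : P \is unitarymx by exact: spectral_unitarymx.
pose d := map_mx (@complex.Re R) (spectral_diag (toC A)).
have dE : toC d = spectral_diag (toC A).
  apply/rowP => i; rewrite !mxE; apply: RRe_real.
  by have /mxOverP := hermitian_spectral_diag_real A_herm; apply.
have /orthomx_spectralP := hermitian_normalmx A_herm.
rewrite -/P -dE => AE.
exists d, P; split=> //; first by rewrite {1}AE invmx_unitary.
apply: (@map_poly_inj _ _ (real_complex R)).
rewrite map_char_poly AE char_poly_conj ?unitarymx_unit // char_poly_trig; last first.
  exact: diag_mx_is_trig.
rewrite rmorph_prod; apply: eq_bigr => i _.
by rewrite rmorphB /= map_polyX map_polyC /= !mxE eqxx.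
Qed.

(** For c = x + i y, the cross terms of the Hermitian form cancel by symmetry
    of M, leaving the sum of the values of the real form at x and at y. *)
Lemma real_quadratic_form_ge0 (R : rcfType) (m : nat) (M : 'M[R]_m) :
  M^T = M -> (forall x : 'rV[R]_m, 0 <= (x *m M *m x^T) 0 0) ->
  forall c : 'rV[R[i]]_m, 0 <= (c *m toC M *m c^t*) 0 0.
Proof.
move=> M_sym M_ge0 c.
pose x := map_mx (@complex.Re R) c; pose y := map_mx (@complex.Im R) c.
have cE : c = toC x + 'i *: toC y.
  by apply/rowP => i; rewrite !mxE -complexiE [LHS]complexE.
have csE : c^t* = toC x^T - 'i *: toC y^T.
  apply/matrixP => i j; rewrite !mxE {1}[c _ _]complexE rmorphD rmorphM /=.
  rewrite complexiE conjCi mulNr.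
  by congr (_ - _ * _); apply/CrealP; apply/complex_realP; eexists.
have xy : (x *m M *m y^T) 0 0 = (y *m M *m x^T) 0 0.
  by rewrite -[in LHS](trmxK (_ *m _)) mxE !trmx_mul trmxK M_sym mulmxA.
suff -> : (c *m toC M *m c^t*) 0 0 =
    ((x *m M *m x^T) 0 0 + (y *m M *m y^T) 0 0)%:C.
  by rewrite ler0c addr_ge0.
rewrite csE {1}cE mulmxBr !mulmxDl -!scalemxAr -!scalemxAl -!map_mxM.
have entryD (U V : 'M[R[i]]_1) : (U + V) 0 0 = U 0 0 + V 0 0 by rewrite mxE.
have entryN (U : 'M[R[i]]_1) : (- U) 0 0 = - U 0 0 by rewrite mxE.
have entryZ a (U : 'M[R[i]]_1) : (a *: U) 0 0 = a * U 0 0 by rewrite mxE.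
have entryC (U : 'M[R]_1) : (toC U) 0 0 = (U 0 0)%:C by rewrite mxE.
rewrite !(entryD, entryN, entryZ, entryC) xy rmorphD /= !mulrA -!expr2 sqrCi.
ring.
Qed.

(** * Courant-Fischer bound and interlacing *)

(** If fewer than m eigenvalues were at least mu, some nonzero c would make
    c U orthogonal to all their eigenvectors; in the eigenbasis the form of
    A - mu at c U would then be a sum of negative multiples of squares. *)
Lemma courant_fischer_ge (R : rcfType) (N m : nat) (A : 'M[R]_N)
    (U : 'M[R]_(m, N)) (mu : R) (k : nat) :
  A^T = A -> row_free U ->
  (forall w : 'rV_N, (w <= U)%MS ->
     mu * (w *m w^T) 0 0 <= (w *m A *m w^T) 0 0) ->
  (k < m)%N -> mu <= (eigenvalues A)`_k.
Proof.
move=> A_sym U_free U_ge km.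
have [d [P [P_unitary AE char_AE]]] := symmetric_spectral A_sym.
rewrite (eigenvalues_char_poly_split char_AE).
apply: nth_decreasing_ge.
  by apply: sort_sorted => x y /=; rewrite orbC le_total.
apply: leq_trans km _; rewrite (seq.permP (permEl (perm_sort _ _))) count_map.
(* S indexes the eigenvalues that are at least mu, and K holds the coordinates
   of the rows of U along the corresponding eigenvectors. *)
pose S := [set i | mu <= d 0 i].
have -> : count (preim (d 0) (>= mu)) (enum 'I_N) = #|S|.
  rewrite cardsE cardE {2}/enum_mem -enumT size_filter; exact: eq_count.
rewrite leqNgt; apply/negP => S_lt.
pose K := colsub (fun j : 'I_#|S| => enum_val j) (toC U *m P^t*).
have ker_neq0 : kermx K != 0.
  rewrite -mxrank_eq0 mxrank_ker subn_eq0 -ltnNge.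
  exact: leq_ltn_trans (rank_leq_col _) S_lt.
have /rowV0Pn[c /sub_kermxP cK c_neq0] := ker_neq0.
(* y is the vector c U expressed in the eigenbasis. *)
pose y := c *m toC U *m P^t*.
have yS i : mu <= d 0 i -> y 0 i = 0.
  move=> di; have iS : i \in S by rewrite inE.
  have /rowP/(_ (enum_rank_in iS i)) := cK.
  rewrite /K mulmx_colsub mulmxA -/y mxE [RHS]mxE enum_rankK_in //.
have yP : y *m P = c *m toC U by rewrite mulmxKtV.
have y_neq0 : y != 0.
  apply: contraNneq c_neq0 => y0; move: yP; rewrite y0 mul0mx => /esym cU0.
  by apply/eqP/(row_free_inj (A := toC U)); rewrite ?row_free_map // cU0 mul0mx.
pose M := U *m (A - mu%:M) *m U^T.
have M_sym : M^T = M.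
  by rewrite /M !trmx_mul trmxK linearB /= A_sym tr_scalar_mx mulmxA.
have M_ge0 (x : 'rV_m) : 0 <= (x *m M *m x^T) 0 0.
  have := U_ge (x *m U) (submxMl _ _).
  rewrite -subr_ge0 /M trmx_mul !mulmxA mulmxBr !mulmxBl mul_mx_scalar.
  by rewrite -!scalemxAl !mxE.
have := real_quadratic_form_ge0 M_sym M_ge0 c.
have -> : (c *m toC M *m c^t*) 0 0 = \sum_i (d 0 i - mu)%:C * `|y 0 i| ^+ 2.
  have AmuE : toC (A - mu%:M) =
      P^t* *m diag_mx (toC (d - const_mx mu)) *m P.
    rewrite map_mxB AE map_mxB linearB /= mulmxBr mulmxBl; congr (_ - _).
    rewrite map_scalar_mx map_const_mx diag_const_mx mul_mx_scalar -scalemxAl.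
    by rewrite -[P^t*]mul1mx mulmxKtV // scalemx1.
  have UE : toC U^T = (toC U)^t*.
    by apply/matrixP => i j; rewrite !mxE; apply/esym/CrealP/complex_realP; eexists.
  rewrite /M !map_mxM AmuE UE !mulmxA -/y -(mulmxA _ P) -(mulmxA _ (P *m _)).
  have -> : P *m (toC U)^t* *m c^t* = y^t*.
    by rewrite /y !trmx_mul !map_mxM /= trmxCK mulmxA.
  rewrite mul_mx_diag mxE; apply: eq_bigr => i _.
  by rewrite !mxE normCK mulrAC mulrC mulrA.
apply/negP/negbT/lt_geF.
have /rV0Pn[i yi] := y_neq0.
rewrite (bigD1 i) //=.
have term_le0 j : (d 0 j - mu)%:C * `|y 0 j| ^+ 2 <= 0.
  case: (leP mu (d 0 j)) => dj; first by rewrite yS // normr0 expr0n mulr0.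
  by rewrite mulr_le0_ge0 ?exprn_ge0 // lecR subr_le0 ltW.
rewrite ltr_nwDl ?sumr_le0 //.
case: (leP mu (d 0 i)) => di; first by rewrite yS ?eqxx in yi.
by rewrite nmulr_rlt0 ?exprn_gt0 ?normr_gt0 // ltcR subr_lt0.
Qed.

(** Eigenvectors of a principal submatrix, padded with zeros, span a space to
    which the Courant-Fischer bound applies.  The eigenvalues are taken
    distinct so that the eigenvectors are orthogonal, which makes both forms
    diagonal in the coordinates along them. *)
Lemma interlacing_of_eigenvectors (R : rcfType) (N n m : nat) (A : 'M[R]_N)
    (f : 'I_n -> 'I_N) (V : 'M[R]_(m, n)) (d : 'rV[R]_m) (mu : R) (k : nat) :
  A^T = A -> injective f -> injective (d 0) -> (forall i, row i V != 0) ->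
  V *m mxsub f f A = diag_mx d *m V -> (forall i, mu <= d 0 i) ->
  (k < m)%N -> mu <= (eigenvalues A)`_k.
Proof.
move=> A_sym f_inj d_inj V_neq0 VB d_ge km.
pose B := mxsub f f A; rewrite -/B in VB.
(* Right multiplication by E pads a vector with zeros outside the image of f. *)
pose E : 'M[R]_(n, N) := rowsub f 1%:M.
have EAE : E *m A *m E^T = B.
  by rewrite mul_rowsub_mx mul1mx trmx_mxsub trmx1 mulmx_colsub mulmx1 -mxsub_comp.
have EE : E *m E^T = 1%:M.
  apply/matrixP => i j; rewrite trmx_mxsub trmx1 mulmx_colsub mulmx1 !mxE.
  by rewrite (inj_eq f_inj).
have B_sym : B^T = B by rewrite /B trmx_mxsub A_sym.
(* The distinct eigenvalues make the Gram matrix of V diagonal, with diagonal g. *)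
pose g : 'rV[R]_m := \row_i (V *m V^T) i i.
have g_gt0 i : 0 < g 0 i.
  have /rV0Pn[j] := V_neq0 i; rewrite mxE => Vij.
  rewrite !mxE (bigD1 j) //= !mxE -expr2 ltr_wpDr ?exprn_even_gt0 //=.
  by rewrite sumr_ge0 // => l _; rewrite mxE -expr2 sqr_ge0.
have GE : V *m V^T = diag_mx g.
  have dG : diag_mx d *m (V *m V^T) = V *m V^T *m diag_mx d.
    rewrite mulmxA -VB -[in LHS]B_sym -mulmxA -trmx_mul VB trmx_mul tr_diag_mx.
    by rewrite mulmxA.
  apply/matrixP => i j; rewrite [RHS]mxE; case: (eqVneq i j) => [->|ij].
    by rewrite mulr1n [RHS]mxE.
  move/matrixP/(_ i j): dG; rewrite mul_diag_mx mul_mx_diag mxE [RHS]mxE.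
  move/eqP; rewrite mulrC -subr_eq0 -mulrBr mulf_eq0 subr_eq0 (inj_eq d_inj).
  by rewrite (negPf ij) orbF => /eqP ->; rewrite mulr0n.
pose U := V *m E.
have UUE : U *m U^T = diag_mx g.
  by rewrite /U trmx_mul mulmxA -(mulmxA V) EE mulmx1.
have UAUE : U *m A *m U^T = diag_mx d *m diag_mx g.
  by rewrite /U trmx_mul !mulmxA -(mulmxA V E) -(mulmxA V (E *m A)) EAE VB -mulmxA GE.
clearbody U g.
have quadE (c h : 'rV[R]_m) : (c *m diag_mx h *m c^T) 0 0 = \sum_i h 0 i * c 0 i ^+ 2.
  by rewrite mul_mx_diag mxE; apply: eq_bigr => i _; rewrite !mxE mulrAC -expr2 mulrC.
apply: (courant_fischer_ge (U := U)) km => //.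
  apply: inj_row_free => c cU; apply/rowP => i; rewrite mxE.
  have /rowP/(_ i) : c *m diag_mx g = 0 by rewrite -UUE mulmxA cU mul0mx.
  rewrite mul_mx_diag mxE [RHS]mxE => /eqP.
  by rewrite mulf_eq0 (gt_eqF (g_gt0 i)) orbF => /eqP.
move=> _ /submxP[c ->]; rewrite trmx_mul !mulmxA.
rewrite -(mulmxA c U A) -!(mulmxA c _ U^T) UUE UAUE mulmx_diag !quadE mulr_sumr.
apply: ler_sum => i _; rewrite mxE mulrA ler_wpM2r ?sqr_ge0 //.
by rewrite ler_wpM2r //; exact: ltW.
Qed.

(** * The paw *)

(** The roots come from the intermediate value theorem; once they are known to
    be distinct, Vieta's relations follow by dividing the differences of
    the root equations by the differences of the roots. *)
Lemma paw_cubic_roots (R : rcfType) :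
  exists a b c : R,
    [/\ 'X^3 - 'X^2 - 3%:R *: 'X + 1 =
          ('X - a%:P) * ('X - b%:P) * ('X - c%:P) :> {poly R},
        c < b, 31%:R / 100%:R < b & b < a].
Proof.
set p : {poly R} := _ + 1.
have pE x : p.[x] = x ^+ 3 - x ^+ 2 - 3%:R * x + 1 by rewrite /p !hornerE.
have [a a_in pa] : {x : R | x \in `]2%:R, 3%:R[ & root p x}.
  by apply: poly_ivtoo; rewrite ?pE; lra.
have [b b_in pb] : {x : R | x \in `](31%:R / 100%:R), 1[ & root p x}.
  by apply: poly_ivtoo; rewrite ?pE; lra.
have [c c_in pc] : {x : R | x \in `](-2%:R), (-1)[ & root p x}.
  by apply: poly_ivtoo; rewrite ?pE; lra.
move: a_in b_in c_in; rewrite !in_itv /= => /andP[a2 a3] /andP[b31 b1] /andP[c2 c1].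
move: pa pb pc => /eqP pa /eqP pb /eqP pc; rewrite !pE in pa pb pc.
have ab_neq0 : a - b != 0 by rewrite subr_eq0 gt_eqF //; lra.
have bc_neq0 : b - c != 0 by rewrite subr_eq0 gt_eqF //; lra.
have ac_neq0 : a - c != 0 by rewrite subr_eq0 gt_eqF //; lra.
have ab : a ^+ 2 + a * b + b ^+ 2 - (a + b) - 3%:R = 0.
  apply: (mulfI ab_neq0); rewrite mulr0 -[RHS](subrr (0 : R)) -{1}pa -pb; ring.
have ac : a ^+ 2 + a * c + c ^+ 2 - (a + c) - 3%:R = 0.
  apply: (mulfI ac_neq0); rewrite mulr0 -[RHS](subrr (0 : R)) -{1}pa -pc; ring.
have e1 : a + b + c = 1.
  apply: (mulfI bc_neq0); apply/eqP; rewrite mulr1 -subr_eq0; apply/eqP.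
  rewrite -[RHS](subrr (0 : R)) -{1}ab -ac; ring.
have cE : c = 1 - a - b by rewrite -e1; ring.
have e2 : a * b + b * c + c * a = - 3%:R.
  by apply/eqP; rewrite -addr_eq0 -oppr_eq0 -ab cE; apply/eqP; ring.
have e3 : a * b * c = - 1.
  have -> : a * b * c = a ^+ 3 - (a + b + c) * a ^+ 2 + (a * b + b * c + c * a) * a.
    ring.
  by rewrite e1 e2; lra.
exists a, b, c; split=> //; [|by lra|by lra].
have -> : ('X - a%:P) * ('X - b%:P) * ('X - c%:P) =
    'X^3 - (a + b + c)%:P * 'X^2 + (a * b + b * c + c * a)%:P * 'X - (a * b * c)%:P.
  rewrite !polyCD !polyCM; ring.
by rewrite e1 e2 e3 /p -mul_polyC !polyCN; ring.
Qed.

Lemma second_largest_root_of_cubic (R : rcfType) (a b c : R) :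
  c <= b -> b <= a ->
  second_largest_root (('X - a%:P) * ('X - b%:P) * ('X - c%:P)) = b.
Proof.
move=> cb ba; rewrite /second_largest_root.
have -> : ('X - a%:P) * ('X - b%:P) * ('X - c%:P) =
    \prod_(x <- [:: a; b; c]) ('X - x%:P).
  by rewrite !big_cons big_nil mulr1 mulrA.
by rewrite dec_roots_prod //= ba cb.
Qed.

(** Vertices 0, 1, 2 form the triangle and 3 hangs from 0. *)
Definition paw_adj (i j : 'I_4) : bool :=
  (i != j) &&
  [|| i == 0 :> nat, j == 0 :> nat | (i != 3 :> nat) && (j != 3 :> nat)].

(** For each root x of the cubic, (x (x - 1), x, x, x - 1) is an eigenvector of
    the paw: the equations at the vertices 1, 2, 3 hold for every x, and the
    equation at the vertex 0 is the cubic. *)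
Lemma second_eigenvalue_of_induced_paw (R : rcfType) (N : nat) (A : 'M[R]_N)
    (f : 'I_4 -> 'I_N) :
  A^T = A -> injective f ->
  (forall i j : 'I_4, A (f i) (f j) = (paw_adj i j)%:R) ->
  second_largest_root ('X^3 - 'X^2 - 3%:R *: 'X + 1) <= (eigenvalues A)`_1.
Proof.
move=> A_sym f_inj A_paw.
have [a [b [c [pE cb b31 ba]]]] := paw_cubic_roots R.
rewrite pE (second_largest_root_of_cubic (ltW cb) (ltW ba)).
have b_gt0 : 0 < b by apply: lt_trans b31; rewrite divr_gt0 ?ltr0n.
have root_eq x : x = a \/ x = b -> x ^+ 3 - x ^+ 2 - 3%:R * x + 1 = 0.
  move=> x_ab; have /(congr1 (horner^~ x)) := pE; rewrite !hornerE => ->.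
  by case: x_ab => ->; rewrite subrr ?mul0r ?mulr0 ?mul0r.
pose d : 'rV[R]_2 := \row_i (if i == 0 then a else b).
have d_eq i : d 0 i = a \/ d 0 i = b by rewrite mxE; case: ifP; [left|right].
have d_ge i : b <= d 0 i by case: (d_eq i) => -> //; exact: ltW.
have d_inj : injective (d 0).
  move=> i j; rewrite !mxE.
  by case: i j => [[|[|?]] ?] [[|[|?]] ?] //= ab;
    first [exact: val_inj | by rewrite ab ltxx in ba].
clearbody d.
pose V : 'M[R]_(2, 4) := \matrix_(i, j)
  [:: d 0 i * (d 0 i - 1); d 0 i; d 0 i; d 0 i - 1]`_j.
apply: (interlacing_of_eigenvectors (f := f) (V := V) (d := d)) => //.
(* Coordinate 1 of each eigenvector is its eigenvalue, which is positive. *)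
- move=> i; apply/eqP => /rowP/(_ (inord 1)); rewrite !mxE inordK //=.
  by apply/eqP; rewrite gt_eqF // (lt_le_trans b_gt0).
- apply/matrixP => i j; rewrite mul_diag_mx [LHS]mxE [RHS]mxE.
  rewrite !big_ord_recr big_ord0 /= !mxE !A_paw /paw_adj /= -!val_eqE /=.
  have := root_eq _ (d_eq i); move: (d 0 i) => x xE.
  case: j => [[|[|[|[|//]]]] ?] /=; rewrite ?mulr1 ?mulr0 ?addr0 ?add0r //; try ring.
  by rewrite -[RHS]subr0 -xE; ring.
Qed.

(** * Power graphs *)

(** The strict order matters: it makes p odd. *)
Lemma two_prime_divisors (n : nat) : (0 < n)%N ->
  ~ (exists p m : nat, prime p /\ n = (p ^ m)%N) ->
  exists p q : nat,
    [/\ prime p, prime q, (p %| n)%N, (q %| n)%N & (q < p)%N].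
Proof.
move=> n_gt0 n_npp.
have n_gt1 : (1 < n)%N.
  rewrite ltn_neqAle n_gt0 andbT; apply/eqP => n1.
  by apply: n_npp; exists 2, 0.
have q_prime := pdiv_prime n_gt1.
have /allPn[p] : ~~ all (mem (pdiv n : nat_pred)) (primes n).
  apply/negP => n_pnat; apply: n_npp.
  have /p_natP[m nE] : (pdiv n).-nat n by rewrite /pnat n_gt0.
  by exists (pdiv n), m.
rewrite mem_primes => /and3P[p_prime _ p_n] pq.
exists p, (pdiv n); split=> //; first exact: pdiv_dvd.
rewrite ltn_neqAle pdiv_min_dvd ?prime_gt1 // andbT eq_sym; exact: pq.
Qed.

Lemma power_adj_sym (gT : finGroupType) : symmetric (@power_adj gT).
Proof. by move=> x y; rewrite /power_adj eq_sym orbC. Qed.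

Lemma power_adj1 (gT : finGroupType) (x : gT) : power_adj 1%g x = (x != 1%g).
Proof. by rewrite /power_adj group1 andbT eq_sym. Qed.

Lemma power_adjV (gT : finGroupType) (x : gT) :
  (2 < #[x]%g)%N -> power_adj x x^-1%g.
Proof.
move=> x_gt2; rewrite /power_adj groupV cycle_id orbT andbT.
apply: contraTneq x_gt2 => x_eqV; rewrite -leqNgt dvdn_leq // order_dvdn.
by rewrite expgS expg1 {2}x_eqV mulgV.
Qed.

Lemma power_adj_prime_orders (gT : finGroupType) (x y : gT) :
  prime #[x]%g -> prime #[y]%g -> #[x]%g != #[y]%g -> power_adj x y = false.
Proof.
move=> x_prime y_prime xy; apply/negbTE.
rewrite /power_adj negb_and negb_or; apply/orP; right.
rewrite -!cycle_subG; apply/andP; split; apply: contraNN xy => /cardSg.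
  by rewrite dvdn_prime2.
by rewrite dvdn_prime2 // eq_sym.
Qed.

Lemma adjmx_sym (R : nzRingType) (T : finType) (V : {set T}) (e : rel T) :
  symmetric e -> (adjmx R V e)^T = adjmx R V e.
Proof. by move=> e_sym; apply/matrixP => i j; rewrite !mxE e_sym. Qed.

Theorem theorem2p4 (R : rcfType) (n : nat) (n_gt0 : (0 < n)%N)
    (n_npp : ~ exists p m : nat, prime p /\ n = (p ^ m)%N)
    (gT : finGroupType) (C : {group gT})
    (C_cyclic : cyclic C) (C_card : #|C| = n) :
  let mu2 := second_largest_root ('X^3 - 'X^2 - 3%:R *: 'X + 1 : {poly R}) in
  mu2 <= lambda2 R C (@power_adj gT) /\ 31%:R / 100%:R < mu2.
Proof.
move=> mu2; split; last first.
  have [a [b [c [pE cb b31 ba]]]] := paw_cubic_roots R.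
  by rewrite /mu2 pE (second_largest_root_of_cubic (ltW cb) (ltW ba)).
have [p [q [p_prime q_prime p_n q_n qp]]] := two_prime_divisors n_gt0 n_npp.
rewrite -C_card in p_n q_n.
have [y yC y_ord] := Cauchy p_prime p_n.
have [x xC x_ord] := Cauchy q_prime q_n.
have y_gt2 : (2 < #[y]%g)%N by rewrite y_ord (leq_ltn_trans (prime_gt1 q_prime)).
have y1 : y != 1%g by rewrite -order_gt1 y_ord prime_gt1.
have x1 : x != 1%g by rewrite -order_gt1 x_ord prime_gt1.
have yV : power_adj y y^-1%g by exact: power_adjV.
have yx : power_adj y x = false.
  by apply: power_adj_prime_orders; rewrite ?y_ord ?x_ord // gtn_eqF.
have yVx : power_adj y^-1%g x = false.
  by apply: power_adj_prime_orders; rewrite ?orderV ?y_ord ?x_ord // gtn_eqF.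
have xx z : @power_adj gT z z = false by rewrite /power_adj eqxx.
pose t := [:: 1%g; y; y^-1%g; x].
have t_uniq : uniq t.
  rewrite /= !inE !negb_or !(eq_sym 1%g) y1 x1 invg_eq1 y1 /=.
  have /andP[-> _] := yV.
  by rewrite andbT; apply/andP; split; apply: contraTneq qp => x_eq;
    rewrite -x_ord -y_ord -?x_eq ?orderV ltnn.
have tC i : nth 1%g t i \in C.
  by case: i => [|[|[|[|i]]]] /=; rewrite ?groupV ?nth_nil.
pose f (i : 'I_4) := enum_rank_in (group1 C) (nth 1%g t i).
have fK i : enum_val (f i) = nth 1%g t i by rewrite enum_rankK_in.
apply: (second_eigenvalue_of_induced_paw (f := f)).
- exact/adjmx_sym/power_adj_sym.
- move=> i j /(congr1 enum_val); rewrite !fK => /eqP.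
  by rewrite nth_uniq ?ltn_ord // => /eqP/val_inj.
move=> i j; rewrite mxE !fK; congr (_%:R).
case: i j => [[|[|[|[|//]]]] ?] [[|[|[|[|//]]]] ?] /=.
(* The second alternative covers the entries below the diagonal. *)
all: first [ by rewrite ?xx ?power_adj1 ?yV ?yx ?yVx ?invg_eq1 ?y1 ?x1
           | by rewrite power_adj_sym ?power_adj1 ?yV ?yx ?yVx ?invg_eq1 ?y1 ?x1].
Qed.
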